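(* If $\mathsf{IKt}2\vdash A$ then $\mathfrak{B}\models A$ for every birelational model $\mathfrak{B}$.
   Context: Formulas: $A ::= P \mid X \mid A\to B \mid \Box A \mid \blacksquare A \mid \forall X A$, with $\bot := \forall XX$, $\neg A := A\to\bot$, $\Diamond A := \forall X(\Box(A\to\blacksquare X)\to X)$, backward diamond $\Diamond^{\bullet} A := \forall X(\blacksquare(A\to\Box X)\to X)$. $\mathsf{IKt}2$: second-order intuitionistic propositional logic (with full comprehension $\forall XA\to A[C/X]$, modus ponens, generalisation with fresh propositional symbol), distribution axioms $\Box(A\to B)\to\Box A\to\Box B$, $\Box(A\to B)\to\Diamond A\to\Diamond B$, $\blacksquare(A\to B)\to\blacksquare A\to\blacksquare B$, $\blacksquare(A\to B)\to\Diamond^{\bullet}A\to\Diamond^{\bullet}B$, necessitation for $\Box$ and $\blacksquare$, and tense axioms $\Diamond^{\bullet}\Box A\to A$, $A\to\Box\Diamond^{\bullet}A$, $\Diamond\blacksquare A\to A$, $A\to\blacksquare\Diamond A$. A birelational model: worlds $W$ with partial order $\le$, class $\mathcal{W}\subseteq\mathcal{P}(W)$ of upward-closed sets, interpretations $P_{\mathfrak{B}}\in\mathcal{W}$, accessibility relation $R$ that is a bisimulation for $\le$ (if $vRw\le w'$ then some $v'\ge v$ has $v'Rw'$; if $v'\ge vRw$ then some $w'\ge w$ has $v'Rw'$); satisfaction: $v\models P$ iff $v\in P_{\mathfrak{B}}$; $v\models A\to B$ iff every $v'\ge v$ satisfying $A$ satisfies $B$; $v\models\Box A$ iff $w'\models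 A$ whenever $v\le v'Rw'$; $v\models\blacksquare A$ iff $u'\models A$ whenever $v\le v'$ and $u'Rv'$; $v\models\forall XA$ iff $v'\models A[V/X]$ for all $v'\ge v$, $V\in\mathcal{W}$ (each $V\in\mathcal{W}$ treated as a symbol interpreted by itself); and comprehensiveness: $\{w : w\models C\}\in\mathcal{W}$ for every closed formula $C$ of the expanded language. $\mathfrak{B}\models A$ means every world satisfies $A$. *)

(* Defs.v *)
From Stdlib Require Export Relation_Definitions.
From Stdlib Require Import Arith Lia.

Set Implicit Arguments.
Unset Strict Implicit.
Unset Printing Implicit Defensive.

(** Formulas are taken up to renaming of bound variables: propositional
    variables are de Bruijn indices, [All A] binds index 0 of [A].
    [T] is the type of propositional symbols. *)
Inductive form (T : Type) : Type :=
| Sym (s : T)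
| Var (x : nat)
| Imp (A B : form T)
| Box (A : form T)
| BBox (A : form T)
| All (A : form T).

Arguments Var {T} x.

Declare Scope form_scope.
Delimit Scope form_scope with form.
Bind Scope form_scope with form.

Notation "A ~> B" := (Imp A B) (at level 55, right associativity) : form_scope.
Notation "□ A" := (Box A) (at level 40, A at level 40) : form_scope.
Notation "■ A" := (BBox A) (at level 40, A at level 40) : form_scope.
Open Scope form_scope.

Section Syntax.
Variable T : Type.
Implicit Types A C : form T.

Definition up_ren (r : nat -> nat) (x : nat) : nat :=
  match x with O => O | S y => S (r y) end.

Fixpoint rename (r : nat -> nat) A : form T :=
  match A with
  | Sym s => Sym s
  | Var x => Var (r x)
  | Imp A B => Imp (rename r A) (rename r B)
  | Box A => Box (rename r A)
  | BBox A => BBox (rename r A)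
  | All A => All (rename (up_ren r) A)
  end.

Definition shift A : form T := rename S A.

Definition up (f : nat -> form T) (x : nat) : form T :=
  match x with O => Var O | S y => shift (f y) end.

Fixpoint subst (f : nat -> form T) A : form T :=
  match A with
  | Sym s => Sym s
  | Var x => f x
  | Imp A B => Imp (subst f A) (subst f B)
  | Box A => Box (subst f A)
  | BBox A => BBox (subst f A)
  | All A => All (subst (up f) A)
  end.

(** [inst A C] is A[C/X], where X is the variable bound in [All A]. *)
Definition inst A C : form T :=
  subst (fun x => match x with O => C | S y => Var y end) A.

Fixpoint closed_below (k : nat) A : Prop :=
  match A with
  | Sym _ => True
  | Var x => x < k
  | Imp A B => closed_below k A /\ closed_below k B
  | Box A | BBox A => closed_below k A
  | All A => closed_below (S k) A
  end.

Definition closed A : Prop := closed_below 0 A.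

Fixpoint occurs (s : T) A : Prop :=
  match A with
  | Sym t => s = t
  | Var _ => False
  | Imp A B => occurs s A \/ occurs s B
  | Box A | BBox A | All A => occurs s A
  end.

Definition Bot : form T := All (Var 0).
Definition Neg A : form T := A ~> Bot.
Definition Dia A : form T := All (□ (shift A ~> ■ Var 0) ~> Var 0).
Definition BDia A : form T := All (■ (shift A ~> □ Var 0) ~> Var 0).

Fixpoint size A : nat :=
  match A with
  | Sym _ | Var _ => 1
  | Imp A B => S (size A + size B)
  | Box A | BBox A | All A => S (size A)
  end.

End Syntax.

Fixpoint map_sym (T U : Type) (f : T -> U) (A : form T) : form U :=
  match A with
  | Sym s => Sym (f s)
  | Var x => Var x
  | Imp A B => Imp (map_sym f A) (map_sym f B)
  | Box A => Box (map_sym f A)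
  | BBox A => BBox (map_sym f A)
  | All A => All (map_sym f A)
  end.

Notation "◇ A" := (Dia A) (at level 40, A at level 40) : form_scope.
Notation "◆ A" := (BDia A) (at level 40, A at level 40) : form_scope.

(** The propositional symbols of the base language: countably many, so that
    a fresh one is always available. *)
Definition symbol : Type := nat.

Reserved Notation "⊢ A" (at level 70, A at level 60).

(** Formulas in a derivation may be open.  Since implication and the second
    order quantifier are the only non-modal connectives, [K], [S] and modus
    ponens give the propositional base. *)
Inductive IKt2 : form symbol -> Prop :=
| ax_K A B : ⊢ A ~> B ~> A
| ax_S A B C : ⊢ (A ~> B ~> C) ~> (A ~> B) ~> A ~> C
| ax_comprehension A C : ⊢ All A ~> inst A C
| rule_mp A B : ⊢ A ~> B -> ⊢ A -> ⊢ B
| rule_gen A B P :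
    ~ occurs P A -> ~ occurs P B ->
    ⊢ B ~> inst A (Sym P) -> ⊢ B ~> All A
| ax_box_K A B : ⊢ □ (A ~> B) ~> □ A ~> □ B
| ax_dia_K A B : ⊢ □ (A ~> B) ~> ◇ A ~> ◇ B
| ax_bbox_K A B : ⊢ ■ (A ~> B) ~> ■ A ~> ■ B
| ax_bdia_K A B : ⊢ ■ (A ~> B) ~> ◆ A ~> ◆ B
| rule_nec_box A : ⊢ A -> ⊢ □ A
| rule_nec_bbox A : ⊢ A -> ⊢ ■ A
| ax_bdia_box A : ⊢ ◆ □ A ~> A
| ax_box_bdia A : ⊢ A ~> □ ◆ A
| ax_dia_bbox A : ⊢ ◇ ■ A ~> A
| ax_bbox_dia A : ⊢ A ~> ■ ◇ A
where "⊢ A" := (IKt2 A).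

(** A birelational model without the comprehensiveness condition, which can
    only be stated once satisfaction is defined. *)
Record birel_structure : Type := {
  world : Type;
  le : world -> world -> Prop;
  le_order : order world le;
  sets : (world -> Prop) -> Prop;
  sets_up : forall V, sets V -> forall v w, le v w -> V v -> V w;
  interp : symbol -> world -> Prop;
  interp_sets : forall P, sets (interp P);
  acc : world -> world -> Prop;
  acc_le : forall v w w', acc v w -> le w w' ->
    exists v', le v v' /\ acc v' w';
  le_acc : forall v v' w, le v v' -> acc v w ->
    exists w', le w w' /\ acc v' w'
}.

Arguments sets : clear implicits.
Arguments interp : clear implicits.

(** Symbols of the expanded language: each member of [sets M] is a symbol. *)
Definition xsymbol (M : birel_structure) : Type :=
  (symbol + {V : world M -> Prop | sets M V})%type.

Definition xinterp (M : birel_structure) (s : xsymbol M) : world M -> Prop :=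
  match s with
  | inl P => interp M P
  | inr V => proj1_sig V
  end.

Section Satisfaction.
Variable M : birel_structure.

Definition set_sym (V : world M -> Prop) (HV : sets M V) : form (xsymbol M) :=
  Sym (inr (exist _ V HV)).

(** The clause for [All] recurses on an instance of the body, which is not a
    subterm but has the same size; [n] bounds the size.  The lemmas
    [sat_Sym], ..., [sat_All] are the resulting satisfaction clauses.
    The value on a free variable is irrelevant. *)
Fixpoint sat_upto (n : nat) (v : world M) (A : form (xsymbol M)) : Prop :=
  match n with
  | 0 => False
  | S n =>
    match A with
    | Sym s => xinterp s v
    | Var _ => False
    | Imp A B => forall v', le v v' -> sat_upto n v' A -> sat_upto n v' B
    | Box A => forall v' w', le v v' -> acc v' w' -> sat_upto n w' A
    | BBox A => forall v' u', le v v' -> acc u' v' -> sat_upto n u' A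
    | All A => forall v', le v v' ->
        forall (V : world M -> Prop) (HV : sets M V),
          sat_upto n v' (inst A (set_sym HV))
    end
  end.

Definition sat (v : world M) (A : form (xsymbol M)) : Prop :=
  sat_upto (size A) v A.

End Satisfaction.

Lemma size_rename (T : Type) (A : form T) : forall r, size (rename r A) = size A.
Proof. induction A; simpl; intros; auto. Qed.

Lemma size_subst (T : Type) (A : form T) :
  forall f, (forall x, size (f x) = 1) -> size (subst f A) = size A.
Proof.
  induction A; simpl; intros f Hf; auto.
  apply f_equal, IHA. intros [|x]; simpl; auto.
  unfold shift. rewrite size_rename. apply Hf.
Qed.

Lemma size_inst_Sym (T : Type) (A : form T) s : size (inst A (Sym s)) = size A.
Proof. apply size_subst. intros [|x]; reflexivity. Qed.

Section Clauses.
Variable M : birel_structure.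
Implicit Types (v : world M) (A B : form (xsymbol M)).

Lemma sat_upto_indep n :
  forall m v A, size A <= n -> size A <= m ->
    (sat_upto n v A <-> sat_upto m v A).
Proof.
  induction n as [|n IH]; intros m v A Hn Hm.
  { destruct A; simpl in Hn; lia. }
  destruct m as [|m]; [destruct A; simpl in Hm; lia|].
  destruct A as [s|x|A B|A|A|A]; simpl in *.
  - reflexivity.
  - reflexivity.
  - split; intros H v' Hv HA.
    + apply (IH m v' B ltac:(lia) ltac:(lia)), H; auto.
      apply (IH m v' A ltac:(lia) ltac:(lia)); auto.
    + apply (IH m v' B ltac:(lia) ltac:(lia)), H; auto.
      apply (IH m v' A ltac:(lia) ltac:(lia)); auto.
  - split; intros H v' w' Hv HR;
      apply (IH m w' A ltac:(lia) ltac:(lia)), (H v'); auto.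
  - split; intros H v' w' Hv HR;
      apply (IH m w' A ltac:(lia) ltac:(lia)), (H v'); auto.
  - assert (E : forall V (HV : sets M V), size (inst A (set_sym HV)) = size A)
      by (intros; apply size_inst_Sym).
    split; intros H v' Hv V HV; specialize (E V HV);
      apply (IH m v' (inst A (set_sym HV)) ltac:(lia) ltac:(lia)); auto.
Qed.

Lemma sat_Sym v s : sat v (Sym s) <-> xinterp s v.
Proof. reflexivity. Qed.

Lemma sat_Imp v A B :
  sat v (A ~> B) <-> forall v', le v v' -> sat v' A -> sat v' B.
Proof.
  set (n := size A + size B).
  assert (EA : forall w, sat_upto n w A <-> sat w A)
    by (intros; apply sat_upto_indep; lia).
  assert (EB : forall w, sat_upto n w B <-> sat w B)
    by (intros; apply sat_upto_indep; lia).
  split; intros H v' Hv HA.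
  - apply EB, H, EA; auto.
  - apply EB, H, EA; auto.
Qed.

Lemma sat_Box v A :
  sat v (□ A) <-> forall v' w', le v v' -> acc v' w' -> sat w' A.
Proof. reflexivity. Qed.

Lemma sat_BBox v A :
  sat v (■ A) <-> forall v' u', le v v' -> acc u' v' -> sat u' A.
Proof. reflexivity. Qed.

Lemma sat_All v A :
  sat v (All A) <->
  forall v', le v v' -> forall V (HV : sets M V), sat v' (inst A (set_sym HV)).
Proof.
  unfold sat, set_sym; simpl.
  split; intros H v' Hv V HV; specialize (H v' Hv V HV); revert H;
    rewrite size_inst_Sym; auto.
Qed.

End Clauses.

Record birel_model : Type := {
  structure :> birel_structure;
  comprehensive : forall C : form (xsymbol structure), closed C ->
    sets structure (fun w => sat w C)
}.

Definition valid (M : birel_model) (A : form symbol) : Prop :=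
  forall w : world M, sat w (map_sym (@inl symbol _) A).

Notation "M ⊨ A" := (valid M A) (at level 70, A at level 60) : form_scope.

(* Main.v *)
Require Import Defs.
From Stdlib Require Import Arith Lia.

Set Implicit Arguments.
Unset Strict Implicit.

(** Satisfaction is first recast as a structurally recursive evaluation [ev]
    under valuations of symbols and variables in the class of sets: a
    derivation may pass through open formulas, and generalisation over a fresh
    symbol [P] is sound because [P] may be revalued.  Comprehensiveness says
    that every [ev]-extension is, up to pointwise equivalence, one of the sets,
    which is what instantiating a quantifier requires.  The tense axioms
    [◇ ■ A ~> A] and [◆ □ A ~> A] instantiate the quantifier of the diamond
    with the extension of [A]; [A ~> □ ◆ A] and [A ~> ■ ◇ A] use the
    bisimulation conditions, by which a world related to one satisfying [A]
    satisfies the corresponding diamond. *)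

Definition scons (X : Type) (a : X) (r : nat -> X) (x : nat) : X :=
  match x with O => a | S y => r y end.

Lemma closed_below_rename (T : Type) (A : form T) : forall k m r,
  (forall x, x < k -> r x < m) -> closed_below k A -> closed_below m (rename r A).
Proof.
  induction A; simpl; intros k m r Hr H; eauto.
  - destruct H; eauto.
  - apply IHA with (S k); auto.
    intros [|x] Hx; simpl; [lia|]. specialize (Hr x). lia.
Qed.

Lemma closed_below_subst (T : Type) (A : form T) : forall k m f,
  (forall x, x < k -> closed_below m (f x)) ->
  closed_below k A -> closed_below m (subst f A).
Proof.
  induction A; simpl; intros k m f Hf H; eauto.
  - destruct H; eauto.
  - apply IHA with (S k); auto.
    intros [|x] Hx; simpl; [lia|].
    apply closed_below_rename with m; [intros; lia|]. apply Hf. lia.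
Qed.

(** For closing an open formula by substituting symbols for all its free variables. *)
Lemma closed_below_subst_all (T : Type) (A : form T) : forall m f,
  (forall x, closed_below m (f x)) -> closed_below m (subst f A).
Proof.
  induction A; simpl; intros m f Hf; auto.
  apply IHA. intros [|x]; simpl; [lia|].
  apply closed_below_rename with m; [intros; lia|]. apply Hf.
Qed.

Lemma closed_below_map_sym (T U : Type) (g : T -> U) (A : form T) : forall k,
  closed_below k A -> closed_below k (map_sym g A).
Proof. induction A; simpl; intuition. Qed.

Section Evaluation.
Variable M : birel_structure.
Local Notation val T := (T -> xsymbol M).

(** Values are symbols rather than predicates, so they always denote sets of the class and can be
    substituted back into formulas. A generic [T] covers the base and the expanded language at
    once. *)
Fixpoint ev (T : Type) (s : val T) (r : val nat) (A : form T) (w : world M)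
  : Prop :=
  match A with
  | Sym P => xinterp (s P) w
  | Var x => xinterp (r x) w
  | Imp A B => forall v, le w v -> ev s r A v -> ev s r B v
  | Box A => forall v u, le w v -> acc v u -> ev s r A u
  | BBox A => forall v u, le w v -> acc u v -> ev s r A u
  | All A => forall v, le w v ->
      forall V : {V | sets M V}, ev s (scons (inr V) r) A v
  end.

Lemma le_rfl (w : world M) : le w w.
Proof. apply (le_order M). Qed.

Lemma le_tr (u v w : world M) : le u v -> le v w -> le u w.
Proof. apply (le_order M). Qed.

Lemma xinterp_up (s : xsymbol M) v w : le v w -> xinterp s v -> xinterp s w.
Proof.
  destruct s as [P|[V HV]]; simpl; apply sets_up;
    [apply interp_sets | exact HV].
Qed.

(** Persistence needs only a case analysis: every compound clause already quantifies over later
    worlds, and atoms denote upward-closed sets. *)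
Lemma ev_up (T : Type) (s : val T) r A v w : le v w -> ev s r A v -> ev s r A w.
Proof.
  destruct A; simpl; eauto using le_tr, xinterp_up.
Qed.

Lemma ev_ext (T : Type) (A : form T) : forall (s s' : val T) r r' w,
  (forall P, occurs P A -> forall v, xinterp (s P) v <-> xinterp (s' P) v) ->
  (forall x v, xinterp (r x) v <-> xinterp (r' x) v) ->
  ev s r A w <-> ev s' r' A w.
Proof.
  induction A as [P|x|A IHA B IHB|A IHA|A IHA|A IHA];
    simpl; intros s s' r r' w Hs Hr; auto.
  - assert (EA : forall v, ev s r A v <-> ev s' r' A v) by (intros; apply IHA; auto).
    assert (EB : forall v, ev s r B v <-> ev s' r' B v) by (intros; apply IHB; auto).
    split; intros H v Hv HA; apply EB, H, EA; auto.
  - split; intros H v u Hv Hu; eapply IHA; eauto; firstorder.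
  - split; intros H v u Hv Hu; eapply IHA; eauto; firstorder.
  - assert (E : forall V v,
        ev s (scons (inr V) r) A v <-> ev s' (scons (inr V) r') A v).
    { intros V v. apply IHA; auto. intros [|x] u; simpl; [tauto|apply Hr]. }
    split; intros H v Hv V; apply E; auto.
Qed.

Lemma ev_rename (T : Type) (A : form T) : forall g (s : val T) r r' w,
  (forall x v, xinterp (r (g x)) v <-> xinterp (r' x) v) ->
  ev s r (rename g A) w <-> ev s r' A w.
Proof.
  induction A as [P|x|A IHA B IHB|A IHA|A IHA|A IHA];
    simpl; intros g s r r' w Hr; auto; try tauto.
  - split; intros H v Hv HA; eapply IHB, H, IHA; eauto.
  - split; intros H v u Hv Hu; eapply IHA; eauto.
  - split; intros H v u Hv Hu; eapply IHA; eauto.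
  - assert (E : forall V v,
        ev s (scons (inr V) r) (rename (up_ren g) A) v <->
        ev s (scons (inr V) r') A v).
    { intros V v. apply IHA. intros [|x] u; simpl; [tauto|apply Hr]. }
    split; intros H v Hv V; apply E; auto.
Qed.

Lemma ev_shift (T : Type) (s : val T) r a A w :
  ev s (scons a r) (shift A) w <-> ev s r A w.
Proof. apply ev_rename. reflexivity. Qed.

Lemma ev_subst (T : Type) (A : form T) : forall f (s : val T) r r' w,
  (forall x v, ev s r (f x) v <-> xinterp (r' x) v) ->
  ev s r (subst f A) w <-> ev s r' A w.
Proof.
  induction A as [P|x|A IHA B IHB|A IHA|A IHA|A IHA];
    simpl; intros f s r r' w Hr; auto; try tauto.
  - split; intros H v Hv HA; eapply IHB, H, IHA; eauto.
  - split; intros H v u Hv Hu; eapply IHA; eauto.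
  - split; intros H v u Hv Hu; eapply IHA; eauto.
  - assert (E : forall V v,
        ev s (scons (inr V) r) (subst (up f) A) v <->
        ev s (scons (inr V) r') A v).
    { intros V v. apply IHA. intros [|x] u; simpl; [tauto|].
      rewrite ev_shift. apply Hr. }
    split; intros H v Hv V; apply E; auto.
Qed.

(** Pointwise agreement of [a] with [C] is asked for because comprehension supplies no more. *)
Lemma ev_inst (T : Type) (s : val T) r A C a w :
  (forall v, ev s r C v <-> xinterp a v) ->
  ev s r (inst A C) w <-> ev s (scons a r) A w.
Proof. intros H. apply ev_subst. intros [|x] v; simpl; [apply H|tauto]. Qed.

Lemma ev_map_sym (T U : Type) (g : T -> U) (A : form T) : forall (s : val U) r w,
  ev s r (map_sym g A) w <-> ev (fun P => s (g P)) r A w.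
Proof.
  induction A as [P|x|A IHA B IHB|A IHA|A IHA|A IHA];
    simpl; intros s r w; try tauto.
  - split; intros H v Hv HA; apply IHB, H, IHA; auto.
  - split; intros H v u Hv Hu; eapply IHA; eauto.
  - split; intros H v u Hv Hu; eapply IHA; eauto.
  - split; intros H v Hv V; apply IHA; auto.
Qed.

(** Induction on a size bound, since [sat_All] passes to an instance; [ev_inst] trades the
    substituted symbol for an extended valuation. *)
Lemma sat_ev r : forall n (A : form (xsymbol M)) w,
  size A <= n -> closed A -> sat w A <-> ev (fun a => a) r A w.
Proof.
  induction n as [|n IH]; intros A w Hn Hc;
    [destruct A; simpl in Hn; lia|].
  destruct A as [P|x|A B|A|A|A]; unfold closed in *; simpl in Hn, Hc.
  - rewrite sat_Sym. reflexivity.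
  - lia.
  - destruct Hc as [HcA HcB]. rewrite sat_Imp. simpl.
    assert (EA : forall v, sat v A <-> ev (fun a => a) r A v)
      by (intros; apply IH; auto; lia).
    assert (EB : forall v, sat v B <-> ev (fun a => a) r B v)
      by (intros; apply IH; auto; lia).
    split; intros H v Hv HA; apply EB, H, EA; auto.
  - rewrite sat_Box. simpl.
    split; intros H v u Hv Hu; apply IH; eauto; lia.
  - rewrite sat_BBox. simpl.
    split; intros H v u Hv Hu; apply IH; eauto; lia.
  - rewrite sat_All. simpl.
    assert (E : forall V (HV : sets M V) v, sat v (inst A (set_sym HV)) <->
        ev (fun a => a) (scons (inr (exist _ V HV)) r) A v).
    { intros V HV v. rewrite <- (@ev_inst _ _ _ _ (set_sym HV)) by reflexivity.
      apply IH.
      - unfold set_sym. rewrite size_inst_Sym. exact (le_S_n _ _ Hn).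
      - apply closed_below_subst with 1; auto.
        intros [|x] Hx; simpl; [exact I|lia]. }
    split.
    + intros H v Hv [V HV]. apply E. auto.
    + intros H v Hv V HV. apply E. auto.
Qed.

End Evaluation.

(* Only pointwise equivalence is claimed: [sets] need not respect it. *)
Lemma ev_comprehension (M : birel_model) (T : Type) (s : T -> xsymbol M) r C :
  exists V : {V | sets M V}, forall w, ev s r C w <-> proj1_sig V w.
Proof.
  (* [D] writes both valuations into [C], giving a closed formula of the expanded language. *)
  set (D := subst (fun x => Sym (r x)) (map_sym s C)).
  assert (HD : closed D) by (apply closed_below_subst_all; simpl; auto).
  exists (exist _ _ (comprehensive HD)). intros w. simpl.
  rewrite (sat_ev r w (le_n _) HD). unfold D.
  rewrite (@ev_subst M _ (map_sym s C) _ _ r r) by reflexivity.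
  rewrite ev_map_sym. reflexivity.
Qed.

Section Soundness.
Variable M : birel_model.
Implicit Types (s : symbol -> xsymbol M) (r : nat -> xsymbol M).

Lemma ev_Dia_intro s r A (u w : world M) : acc u w -> ev s r A w -> ev s r (◇ A) u.
Proof.
  simpl. intros Huw HA v Hv V v' Hv' H.
  (* [A] persists to [w'], so [H] yields [■] of the bound variable there; going back along [acc]
     lands in [V] at [v']. *)
  destruct (le_acc (le_tr Hv Hv') Huw) as [w' [Hw' Hvw']].
  apply (H v' w' (le_rfl v') Hvw' w' (le_rfl w')) with w'; auto using le_rfl.
  apply ev_shift, ev_up with w; auto.
Qed.

Lemma ev_BDia_intro s r A (u w : world M) : acc w u -> ev s r A w -> ev s r (◆ A) u.
Proof.
  simpl. intros Hwu HA v Hv V v' Hv' H.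
  destruct (acc_le Hwu (le_tr Hv Hv')) as [w' [Hw' Hwv']].
  apply (H v' w' (le_rfl v') Hwv' w' (le_rfl w')) with w'; auto using le_rfl.
  apply ev_shift, ev_up with w; auto.
Qed.

Lemma soundness A : IKt2 A -> forall s r (w : world M), ev s r A w.
Proof.
  induction 1 as
    [A B|A B C|A C|A B _ IHAB _ IHA|A B P HPA HPB _ IH|A B|A B|A B|A B
    |A _ IH|A _ IH|A|A|A|A]; intros s r w.
  - intros v _ HA u Hu _. apply ev_up with v; auto.
  - intros v _ H1 u Hvu H2 t Hut HA.
    apply (H1 t (le_tr Hvu Hut) HA t (le_rfl t)). exact (H2 t Hut HA).
  - intros v _ H. destruct (ev_comprehension s r C) as [V HV].
    apply (@ev_inst _ _ _ _ _ _ (inr V)); auto. apply H, le_rfl.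
  - apply (IHAB s r w w (le_rfl w)), IHA.
  - intros v _ HB u Hu V.
    (* Revaluing the fresh [P] as [V] changes neither [A] nor [B], and turns the instance at [P]
       into the one at [V]. *)
    set (s' := fun Q => if Nat.eq_dec Q P then inr V else s Q).
    assert (Hs' : forall F r' t, ~ occurs P F -> ev s r' F t <-> ev s' r' F t).
    { intros F r' t HP. apply ev_ext; [|reflexivity].
      intros Q HQ x. unfold s'.
      destruct (Nat.eq_dec Q P) as [->|_]; tauto. }
    apply ev_up with v; auto. apply Hs'; auto.
    apply (@ev_inst _ _ _ _ _ (Sym P) (inr V)).
    { intros t. simpl. unfold s'.
      destruct (Nat.eq_dec P P); [reflexivity|congruence]. }
    apply (IH s' r v v (le_rfl v)), Hs'; auto.
  - intros v _ H1 u Hvu H2 t x Hut Htx.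
    apply (H1 t x (le_tr Hvu Hut) Htx x (le_rfl x)). exact (H2 t x Hut Htx).
  - intros v _ H1 u Hvu H2 t Hut V t' Ht' H3.
    (* For the same [V], [□ (A ~> B)] and [□ (B ~> ■ V)] compose to [□ (A ~> ■ V)], which [◇ A]
       consumes. *)
    apply (H2 t Hut V t' Ht').
    intros x y Hx Hxy z Hyz HA.
    apply (H3 x y Hx Hxy z Hyz), ev_shift.
    apply (H1 x y (le_tr Hvu (le_tr Hut (le_tr Ht' Hx))) Hxy z Hyz).
    apply ev_shift in HA; exact HA.
  - intros v _ H1 u Hvu H2 t x Hut Htx.
    apply (H1 t x (le_tr Hvu Hut) Htx x (le_rfl x)). exact (H2 t x Hut Htx).
  - intros v _ H1 u Hvu H2 t Hut V t' Ht' H3.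
    apply (H2 t Hut V t' Ht').
    intros x y Hx Hxy z Hyz HA.
    apply (H3 x y Hx Hxy z Hyz), ev_shift.
    apply (H1 x y (le_tr Hvu (le_tr Hut (le_tr Ht' Hx))) Hxy z Hyz).
    apply ev_shift in HA; exact HA.
  - intros v u _ _. apply IH.
  - intros v u _ _. apply IH.
  - intros v _ H. destruct (ev_comprehension s r A) as [V HV].
    apply HV, (H v (le_rfl v) V v (le_rfl v)).
    intros x y _ _ z _ HA t u Hzt Htu. apply HV.
    apply ev_shift in HA. exact (HA t u Hzt Htu).
  - intros v _ HA u t Hvu Hut.
    apply ev_BDia_intro with u; auto. apply ev_up with v; auto.
  - intros v _ H. destruct (ev_comprehension s r A) as [V HV].
    apply HV, (H v (le_rfl v) V v (le_rfl v)).
    intros x y _ _ z _ HA t u Hzt Htu. apply HV.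
    apply ev_shift in HA. exact (HA t u Hzt Htu).
  - intros v _ HA u t Hvu Hut.
    apply ev_Dia_intro with u; auto. apply ev_up with v; auto.
Qed.

End Soundness.

Theorem theorem3p4 (A : form symbol) (hA : closed A) :
  IKt2 A -> forall B : birel_model, B ⊨ A.
Proof.
  intros HA B w.
  (* The symbol [inl 0] is an arbitrary default value for variables, as [A] is closed. *)
  apply (sat_ev (fun _ => inl 0) w (le_n _)).
  - apply closed_below_map_sym, hA.
  - apply ev_map_sym, (soundness HA).
Qed.
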